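(* Let $\alpha\in\mathbb{C}\setminus\{0\}$ and let $R,S,T\in\mathcal{B}(\mathcal{H})$ with $T\in\mathcal{A}_\alpha$. Then $$\omega(STR)\le\frac1{|\alpha|}\bigl(\|R\|\|S\|+\omega(SR)\bigr).$$
   Context: $\mathcal{H}$ is a separable nontrivial complex Hilbert space, $\mathcal{B}(\mathcal{H})$ is the algebra of bounded linear operators on $\mathcal{H}$ with the operator norm, and $I$ is the identity operator. For $\alpha\in\mathbb{C}\setminus\{0\}$, $\mathcal{A}_\alpha=\{T\in\mathcal{B}(\mathcal{H}):\|\alpha T-I\|\le1\}$. $\omega(T)=\sup\{|\langle Tx,x\rangle|:x\in\mathcal{H},\|x\|=1\}$ is the numerical radius. *)

(* Defs.v *)
From HB Require Import structures.
From mathcomp Require Import all_boot all_order all_algebra.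
From mathcomp Require Import sesquilinear complex.
From mathcomp Require Import all_classical all_reals.
From mathcomp Require Import topology normedtype.

Set Implicit Arguments.
Unset Strict Implicit.
Unset Printing Implicit Defensive.

Import Order.TTheory GRing.Theory Num.Theory.
Import numFieldNormedType.Exports.

Local Open Scope classical_set_scope.
Local Open Scope ring_scope.
Local Open Scope complex_scope.

Definition separable (T : topologicalType) : Prop :=
  exists2 D : set T, countable D & dense D.

(* Norms over the scalar field K[i] take their values in K[i] (with zero
   imaginary part); [rnorm] is the same norm with values in K, where suprema
   and the total order live. *)
Definition rnorm (K : realType) (V : normedZmodType K[i]) (x : V) : K :=
  complex.Re `|x|.

Lemma rnormE (K : realType) (V : normedZmodType K[i]) (x : V) :
  (rnorm x)%:C = `|x|.
Proof. by apply: RRe_real; rewrite realE normr_ge0. Qed.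

(* A Hilbert space over K[i] is a complete normed module whose norm comes from
   the inner product [dot]; forms of type {dot H for Num.conj} are linear in
   the first argument and conjugate-linear in the second. *)
Definition norm_from_dot (K : realType) (H : completeNormedModType K[i])
    (dot : {dot H for @Num.conj K[i]}) : Prop :=
  forall x : H, `|x| ^+ 2 = dot x x.

Section Operators.
Context {K : realType} {H : completeNormedModType K[i]}.

Definition bounded_operator (T : {linear H -> H}) : Prop :=
  exists M : K, forall x : H, rnorm (T x) <= M * rnorm x.

Lemma bounded_operatorP (T : {linear H -> H}) :
  bounded_operator T <-> continuous T.
Proof.
rewrite -linear_bounded_continuous; split=> [[M TM]|].
  apply/linear_boundedP; near=> r => x.
  have TMx : `|T x| <= M%:C * `|x|.
    by rewrite -2!rnormE -rmorphM lecR.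
  apply: (le_trans TMx); rewrite ler_wpM2r//; near: r.
  by apply: nbhs_pinfty_ge; rewrite complex_real.
move=> /linear_boundedP/pinfty_ex_gt0[r r0 Tr].
exists (complex.Re r) => x.
have := Tr x; rewrite -2!rnormE -{1}[r]RRe_real ?gtr0_real//.
by rewrite -rmorphM lecR.
Unshelve. all: by end_near. Qed.

(* For a bounded linear T both sets below are bounded, and the second is
   nonempty as soon as H is nontrivial, so that [sup] is the true supremum. *)
Definition opnorm (T : H -> H) : K :=
  sup [set rnorm (T x) | x in [set x : H | rnorm x <= 1]].

Definition numerical_radius (dot : {dot H for @Num.conj K[i]})
    (T : H -> H) : K :=
  sup [set rnorm (dot (T x) x) | x in [set x : H | rnorm x = 1]].

Definition class_A (alpha : K[i]) : set {linear H -> H} :=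
  [set T | bounded_operator T /\ opnorm (alpha \*: T \- idfun) <= 1].

End Operators.

(* Main.v *)
Require Import Defs.
From mathcomp Require Import all_boot all_order all_algebra.
From mathcomp Require Import sesquilinear complex.
From mathcomp Require Import all_classical all_reals.
From mathcomp Require Import topology normedtype.

(** The identity [alpha STR = S (alpha T - I) R + SR] splits the numerical
    radius.  For a unit vector [x], Cauchy-Schwarz bounds the first summand:
    |<S (alpha T - I) R x, x>| <= ||S|| ||alpha T - I|| ||R|| <= ||S|| ||R||,
    because [T] is in the class [A_alpha]; the second summand contributes at
    most [omega(SR)].  Dividing by [|alpha|] and taking the supremum over [x]
    gives the inequality.

    A supremum in K is an upper bound only of a set that is bounded above.
    This is why [rnorm_le_opnorm] and [rnorm_dot_le_numerical_radius] ask for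
    a bounded operator, and why boundedness is shown to pass to compositions
    and to [alpha T - I].  The final supremum can be bounded pointwise because
    the unit sphere of a nontrivial space is nonempty. *)

Import Order.TTheory GRing.Theory Num.Theory.

Local Open Scope ring_scope.

(** Expand the positive number <w, w> for [w = <v, v> u - <u, v> v], which is
    [<v, v>] times the component of [u] orthogonal to [v]. *)
Lemma dot_cauchy_schwarz (C : numClosedFieldType) (U : lmodType C)
    (dot : {dot U for @Num.conj C}) (u v : U) :
  `|dot u v| ^+ 2 <= dot u u * dot v v.
Proof.
have [->|v0] := eqVneq v 0; first by rewrite !linear0r normr0 expr0n mulr0.
have a_gt0 : 0 < dot v v by rewrite (dnorm_gt0 dot).
have := dnorm_ge0 dot (dot v v *: u - dot u v *: v).
rewrite dnormB !dnormZ linearZl_LR linearZr_LR /=.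
rewrite (ger0_norm (ltW a_gt0)).
set a := dot v v in a_gt0 *; set d := dot u v.
have -> : a * (d^* * d) = a * `|d| ^+ 2 by rewrite normCKC.
have -> : (a * `|d| ^+ 2)^* = a * `|d| ^+ 2.
  by apply/conj_Creal; rewrite rpredM ?rpredX ?normr_real ?gtr0_real.
rewrite [`|d| ^+ 2 * a]mulrC opprD addrA addrK expr2 -mulrA -mulrBr.
by rewrite pmulr_rge0 // subr_ge0 mulrC.
Qed.

Local Open Scope complex_scope.

Section RealNorm.
Variable K : realType.

Lemma rnorm_real_complex (r : K) : 0 <= r -> rnorm r%:C = r.
Proof. by move=> r0; apply/complexI; rewrite rnormE ger0_norm // lecR. Qed.

Lemma rnormM (a b : K[i]) : rnorm (a * b) = rnorm a * rnorm b.
Proof. by apply/complexI; rewrite rmorphM /= !rnormE normrM. Qed.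

Section NormedZmod.
Variable V : normedZmodType K[i].
Implicit Types x y : V.

Lemma rnorm_ge0 x : 0 <= rnorm x.
Proof. by rewrite -lecR rnormE normr_ge0. Qed.

Lemma rnorm_gt0 x : (0 < rnorm x) = (x != 0).
Proof. by rewrite -ltcR rnormE normr_gt0. Qed.

Lemma rnorm0 : rnorm (0 : V) = 0.
Proof. by rewrite /rnorm normr0. Qed.

Lemma ler_rnormD x y : rnorm (x + y) <= rnorm x + rnorm y.
Proof. by rewrite -lecR rmorphD /= !rnormE ler_normD. Qed.

Lemma ler_rnormB x y : rnorm (x - y) <= rnorm x + rnorm y.
Proof. by rewrite -lecR rmorphD /= !rnormE ler_normB. Qed.

End NormedZmod.

Section NormedMod.
Variable V : normedModType K[i].
Implicit Types x : V.

Lemma rnormZ (a : K[i]) x : rnorm (a *: x) = rnorm a * rnorm x.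
Proof. by apply/complexI; rewrite rmorphM /= !rnormE normrZ. Qed.

Lemma rnorm_unit_exists : (exists x, x <> 0) -> exists x, rnorm x = 1.
Proof.
move=> [x /eqP x0]; exists ((rnorm x)^-1%:C *: x).
have x_gt0 : 0 < rnorm x by rewrite rnorm_gt0.
by rewrite rnormZ rnorm_real_complex ?invr_ge0 ?ltW // mulVf // gt_eqF.
Qed.

End NormedMod.

End RealNorm.

Section BoundedOperators.
Variables (K : realType) (H : completeNormedModType K[i]).
Implicit Types (T : {linear H -> H}).

Lemma bounded_operator_comp S T :
  bounded_operator S -> bounded_operator T -> bounded_operator (S \o T).
Proof.
rewrite !bounded_operatorP => cS cT x.
exact: (@continuous_comp _ _ _ T S x (cT x) (cS _)).
Qed.

Lemma bounded_operator_scaleB_id (a : K[i]) T :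
  bounded_operator T -> bounded_operator (a \*: T \- idfun).
Proof.
move=> [M TM]; exists (rnorm a * M + 1) => x /=.
rewrite (le_trans (ler_rnormB _ _ _ _)) // mulrDl mul1r lerD2r rnormZ -mulrA.
by rewrite ler_wpM2l // rnorm_ge0.
Qed.

Lemma rnorm_le_opnorm_unit_ball T x :
  bounded_operator T -> rnorm x <= 1 -> rnorm (T x) <= opnorm T.
Proof.
move=> [M TM] x1; apply: ub_le_sup; last by exists x.
(* The bound [M] of a bounded operator may be negative, hence [`|M|]. *)
exists `|M| => _ [y /= y1 <-]; apply: (le_trans (TM y)).
rewrite (le_trans (ler_norm _)) // normrM (ger0_norm (rnorm_ge0 _ _ y)).
by rewrite ler_piMr.
Qed.

Lemma opnorm_ge0 T : bounded_operator T -> 0 <= opnorm T.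
Proof.
move=> bT; rewrite (le_trans _ (rnorm_le_opnorm_unit_ball T 0 bT _)) //.
  exact: rnorm_ge0.
by rewrite rnorm0.
Qed.

(** Homogeneity reduces the estimate to the unit vector [x / |x|]. *)
Lemma rnorm_le_opnorm T x :
  bounded_operator T -> rnorm (T x) <= opnorm T * rnorm x.
Proof.
move=> bT.
have [->|x0] := eqVneq x 0; first by rewrite linear0 rnorm0 mulr0.
have x_gt0 : 0 < rnorm x by rewrite rnorm_gt0.
have rV : rnorm (rnorm x)^-1%:C = (rnorm x)^-1.
  by rewrite rnorm_real_complex // invr_ge0 ltW.
rewrite -ler_pdivrMr // mulrC -rV -rnormZ -linearZ.
by apply: rnorm_le_opnorm_unit_ball; rewrite // rnormZ rV mulVf // gt_eqF.
Qed.

Variables (dot : {dot H for @Num.conj K[i]}) (Hdot : norm_from_dot dot).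

Lemma rnorm_dot_le (x y : H) : rnorm (dot x y) <= rnorm x * rnorm y.
Proof.
rewrite -lecR rmorphM /= !rnormE -(@ler_pXn2r _ 2) ?nnegrE ?mulr_ge0 //.
by rewrite exprMn !Hdot dot_cauchy_schwarz.
Qed.

(** Cauchy-Schwarz shows that [opnorm T] bounds the set whose supremum is the
    numerical radius. *)
Lemma rnorm_dot_le_numerical_radius T x :
  bounded_operator T -> rnorm x = 1 ->
  rnorm (dot (T x) x) <= numerical_radius dot T.
Proof.
move=> bT x1; apply: ub_le_sup; last by exists x.
exists (opnorm T) => _ [y /= y1 <-]; apply: (le_trans (rnorm_dot_le _ _)).
by rewrite y1 mulr1 (le_trans (rnorm_le_opnorm _ y bT)) // y1 mulr1.
Qed.

End BoundedOperators.

Theorem theorem4p2 (K : realType) (H : completeNormedModType K[i])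
  (dot : {dot H for @Num.conj K[i]}) (Hdot : norm_from_dot dot)
  (Hsep : separable H) (Hnontriv : exists x : H, x <> 0)
  (alpha : K[i]) (alpha0 : alpha <> 0) (R S T : {linear H -> H})
  (hR : bounded_operator R) (hS : bounded_operator S)
  (hT : class_A alpha T) :
  numerical_radius dot (S \o T \o R) <=
    (rnorm alpha)^-1 *
      (opnorm R * opnorm S + numerical_radius dot (S \o R)).
Proof.
have [u u1] := rnorm_unit_exists _ _ Hnontriv.
case: hT => bT /= hA.
have alpha_gt0 : 0 < rnorm alpha by rewrite rnorm_gt0; apply/eqP.
apply: ge_sup => [|_ [x /= x1 <-]].
  by exists (rnorm (dot (S (T (R u))) u)), u.
rewrite ler_pdivlMl // -rnormM.
pose A := alpha \*: T \- idfun.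
have bA : bounded_operator A by exact: bounded_operator_scaleB_id.
have -> : alpha * dot (S (T (R x))) x = dot (S (A (R x))) x + dot (S (R x)) x.
  by rewrite -linearDl -linearD /= subrK linearZ linearZl_LR.
apply: (le_trans (ler_rnormD _ _ _ _)); apply: lerD; last first.
  have bSR := bounded_operator_comp _ _ S R hS hR.
  exact: (rnorm_dot_le_numerical_radius _ _ _ Hdot _ x bSR x1).
apply: (le_trans (rnorm_dot_le _ _ _ Hdot _ _)); rewrite x1 mulr1.
apply: (le_trans (rnorm_le_opnorm _ _ _ _ hS)); rewrite mulrC.
apply: ler_wpM2r; first exact: opnorm_ge0.
apply: (le_trans (rnorm_le_opnorm _ _ _ _ bA)).
apply: le_trans (_ : rnorm (R x) <= _).
  by rewrite ler_piMl // rnorm_ge0.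
by rewrite (le_trans (rnorm_le_opnorm _ _ _ x hR)) // x1 mulr1.
Qed.
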